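(* Let $G$ be a graph product of groups $G_i$, $1\le i\le n$, over a finite simplicial graph $\Lambda$ with vertices $v_1,\dots,v_n$ ($G_i$ attached to $v_i$). Let $X=\bigcup_{i=1}^nX_i$, where $X_i$ is a finite inverse-closed generating set for $G_i$, let $\Gamma_i:=\Gamma(G_i,X_i)$ be the geodesic language for each $i$, and let $y\in X^*$. The following are equivalent. (i) $y$ is a geodesic word for $G$ with respect to $X$. (ii) $y$ is a trimmed word over $X$. (iii) $y\in\bigcap_{i=1}^n\pi_i^{-1}\big(\Gamma_i(\$\,\Gamma_i)^*\big)$. (iv) $y$ can be transformed into $\Theta(y)$ by a finite (possibly zero) number of operations of types (x1) and (x2).
   Context: Graph product: the group generated by the vertex groups, subject to the relations of the vertex groups together with the relations that elements of distinct adjacent vertex groups commute. The sets $X_i$ are regarded as pairwise disjoint sets of letters. For a group $K$ with generating set $Y$, a geodesic is a word over $Y$ of minimal length among all words over $Y$ representing the same element of $K$; $\Gamma(K,Y)$ is the set of all geodesics. For $u,w\in X_i^*$ write $u=_{G_i}w$ if they represent the same element of $G_i$; $l$ denotes word length. Operations on words over $X$ (with $y,z\in X^*$): (x0) Local reduction: $yuz\to ywz$ with $u,w\in X_i^*$, $u=_{G_i}w$, $l(u)>l(w)$. (x1) Local exchange: $yuz\to ywz$ with $u,w\in X_i^*$, $u=_{G_i}w$, $l(u)=l(w)$. (x2) Shuffle: $yuwz\to ywuz$ with $u\in X_i^*$, $w\in X_j^*$, and $v_i,v_j$ adjacent in $\Lambda$. A word $y\in X^*$ is trimmed if no finite sequence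 of operations of types (x0)–(x2) starting at $y$ ever contains an operation of type (x0). Let $C_i$ be the union of those $X_j$ for which $v_j$ is adjacent to $v_i$. For a letter $\$\notin X$, $\pi_i:X^*\to(X_i\cup\{\$\})^*$ is the monoid homomorphism with $\pi_i(a)=a$ if $a\in X_i$, $\pi_i(a)=\$$ if $a\in X\setminus(X_i\cup C_i)$, and $\pi_i(a)$ the empty word if $a\in C_i$. Definition of $\Theta$. Let $T$ be the set of all nonempty subsets $t\subseteq X$ such that the set $\{v_i : t\cap X_i\ne\emptyset\}$ is a clique of $\Lambda$ and $|t\cap X_i|\le1$ for each $i$. Each $t\in T$ represents the element of $G$ which is the product of its (pairwise commuting) elements; a letter $a\in X$ is identified with $\{a\}\in T$, so that $X^*\subseteq T^*$. The empty set denotes the empty word over $T$. When $a\in X$, $t\in T\cup\{\emptyset\}$, $a\notin t$ and $t\cup\{a\}\in T$, write $\{a,t\}:=t\cup\{a\}$. For each $i$ fix a total ordering of $X_i$ and let $<_i$ be the corresponding shortlex ordering on $X_i^*$. Let $R$ be the set of the following rewriting rules, applied to subwords of words over $T$: (R0) $\{a_1,t_1\}\cdots\{a_m,t_m\}\to\{b_1,t_1\}\cdots\{b_k,t_k\}t_{k+1}\cdots t_m$ whenever for some $i$ all $a_j,b_j\in X_i$, all $t_j\in T\cup\{\emptyset\}$, $\{a_j,t_j\}\in T$, $k<m$, and $a_1\cdots a_m=_{G_i}b_1\cdots b_k$. (R1) $\{a_1,t_1\}\cdots\{a_m,t_m\}\to\{b_1,t_1\}\cdots\{b_m,t_m\}$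 whenever for some $i$ all $a_j,b_j\in X_i$, all $t_j\in T\cup\{\emptyset\}$, $\{a_j,t_j\}\in T$, $a_1\cdots a_m=_{G_i}b_1\cdots b_m$, and $a_1\cdots a_m>_ib_1\cdots b_m$. (R2) $t\{a,t'\}\to\{a,t\}t'$ whenever $a\in X$, $t\in T$, $t'\in T\cup\{\emptyset\}$, and $\{a,t\},\{a,t'\}\in T$. The system $R$ is terminating and confluent, so each word $w\in X^*$ (viewed in $T^*$) can be rewritten by finitely many applications of rules of $R$ to a unique word $\mathrm{irr}(w)\in T^*$ to which no rule applies. For each $t\in T$ choose an ordered listing $a_1,\dots,a_k$ of its elements and put $h(t):=a_1\cdots a_k\in X^*$; this extends to a monoid homomorphism $h:T^*\to X^*$. Define $\Theta(w):=h(\mathrm{irr}(w))$ for $w\in X^*$. *)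

(* Defs.v *)
From HB Require Import structures.
From Stdlib Require Import Relation_Operators.
From mathcomp Require Import all_boot finmap.
From mathcomp Require Import boolp classical_sets.

Set Implicit Arguments.
Unset Strict Implicit.
Unset Printing Implicit Defensive.

Local Open Scope group_scope.
Local Open Scope quotient_scope.

Definition reachable (A : Type) (step : A -> A -> Prop) : A -> A -> Prop :=
  clos_refl_trans A step.

Section Words.
Variables (K : groupType) (A : Type) (ev : A -> K).

Definition eval (w : seq A) : K := \prod_(a <- w) ev a.

Definition geodesic : set (seq A) :=
  fun w => forall w' : seq A, eval w' = eval w -> (size w <= size w')%N.

End Words.

Definition inverse_closed (K : groupType) (Y : {fset K}) : Prop :=
  forall x : K, x \in Y -> x^-1 \in Y.

Definition generates (K : groupType) (Y : {fset K}) : Prop :=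
  forall g : K, exists s : seq K,
    (forall x, x \in s -> x \in Y \/ x^-1 \in Y) /\ g = \prod_(x <- s) x.

Section Languages.
Variable A : Type.

Definition lang_cat (L M : set (seq A)) : set (seq A) :=
  fun w => exists u v, [/\ L u, M v & w = u ++ v].

Inductive lang_star (L : set (seq A)) : seq A -> Prop :=
| lang_star_nil : lang_star L [::]
| lang_star_cat u v : L u -> lang_star L v -> lang_star L (u ++ v).

End Languages.

(* The graph product is the presented group: words in the disjoint union of
   the G i, modulo the congruence generated by the multiplication tables of
   the G i and the commutations along edges.  Formal inverses are not needed
   as generators, since each G i is closed under inversion. *)
Section GraphProduct.
Variables (n : nat) (adj : rel 'I_n) (G : 'I_n -> groupType).

Definition syllable : Type := {i : 'I_n & G i}.
HB.instance Definition _ := Choice.on syllable.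

Definition syl (i : 'I_n) (g : G i) : syllable := Tagged G g.

Inductive gp_eq : seq syllable -> seq syllable -> Prop :=
| gp_mul i (g h : G i) : gp_eq [:: syl g; syl h] [:: syl (g * h)]
| gp_one i : gp_eq [:: syl (1 : G i)] [::]
| gp_comm i j (g : G i) (h : G j) : adj i j ->
    gp_eq [:: syl g; syl h] [:: syl h; syl g]
| gp_refl u : gp_eq u u
| gp_sym u v : gp_eq u v -> gp_eq v u
| gp_trans u v w : gp_eq u v -> gp_eq v w -> gp_eq u w
| gp_cat u u' v v' : gp_eq u u' -> gp_eq v v' -> gp_eq (u ++ v) (u' ++ v').

Definition gp_eqb : rel (seq syllable) := fun u v => `[< gp_eq u v >].

Lemma gp_eqb_equiv : equiv_class_of gp_eqb.
Proof.
split=> [u|u v|v u w].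
- exact/asboolP/gp_refl.
- by apply/asboolP/asboolP; apply: gp_sym.
- by move=> /asboolP uv /asboolP vw; apply/asboolP; apply: gp_trans uv vw.
Qed.

Canonical gp_equiv := EquivRelPack gp_eqb_equiv.

Definition graph_product : Type := {eq_quot gp_equiv}.
HB.instance Definition _ := Choice.on graph_product.

Definition gp_class (u : seq syllable) : graph_product :=
  \pi_({eq_quot gp_equiv}) u.

Definition gp_repr (x : graph_product) : seq syllable :=
  repr (x : {eq_quot gp_equiv}).

Lemma gp_classP u v : gp_class u = gp_class v <-> gp_eq u v.
Proof.
by split=> [/eqmodP/asboolP//|uv]; apply/eqmodP; apply/asboolP.
Qed.

Lemma gp_reprK x : gp_class (gp_repr x) = x.
Proof. exact: reprK. Qed.

Lemma gp_repr_class u : gp_eq (gp_repr (gp_class u)) u.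
Proof. by apply/gp_classP; rewrite gp_reprK. Qed.

Definition syl_inv (s : syllable) : syllable := syl (tagged s)^-1.
Definition word_inv (u : seq syllable) : seq syllable := rev (map syl_inv u).

Definition gp_mulg (x y : graph_product) : graph_product :=
  gp_class (gp_repr x ++ gp_repr y).
Definition gp_invg (x : graph_product) : graph_product :=
  gp_class (word_inv (gp_repr x)).

Lemma gp_mulgE u v : gp_mulg (gp_class u) (gp_class v) = gp_class (u ++ v).
Proof. by apply/gp_classP; apply: gp_cat; apply: gp_repr_class. Qed.

Lemma gp_mulgA : associative gp_mulg.
Proof.
move=> x y z; rewrite -(gp_reprK x) -(gp_reprK y) -(gp_reprK z).
by rewrite !gp_mulgE catA.
Qed.

Lemma gp_mul1g : left_id (gp_class [::]) gp_mulg.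
Proof. by move=> x; rewrite -(gp_reprK x) gp_mulgE. Qed.

Lemma gp_mulg1 : right_id (gp_class [::]) gp_mulg.
Proof. by move=> x; rewrite -(gp_reprK x) gp_mulgE cats0. Qed.

Lemma word_inv_cons s u : word_inv (s :: u) = word_inv u ++ [:: syl_inv s].
Proof. by rewrite /word_inv /= rev_cons -cats1. Qed.

Lemma word_invV u : gp_eq (word_inv u ++ u) [::].
Proof.
elim: u => [|[i g] u IHu]; first exact: gp_refl.
rewrite word_inv_cons -catA /=; apply: gp_trans IHu.
apply: gp_cat; first exact: gp_refl.
rewrite -[_ :: _ :: u]/([:: syl g^-1; syl g] ++ u) -{2}[u]cat0s.
apply: gp_cat; last exact: gp_refl.
by apply: gp_trans (gp_mul _ _) _; rewrite mulVg; apply: gp_one.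
Qed.

Lemma wordVinv u : gp_eq (u ++ word_inv u) [::].
Proof.
elim: u => [|[i g] u IHu]; first exact: gp_refl.
rewrite word_inv_cons /= catA -[_ :: _]/([:: syl g] ++ (_ ++ _)).
apply: (@gp_trans _ ([:: syl g] ++ ([::] ++ [:: syl g^-1]))).
  by apply: gp_cat; [apply: gp_refl|apply: gp_cat => //; apply: gp_refl].
by apply: gp_trans (gp_mul _ _) _; rewrite mulgV; apply: gp_one.
Qed.

Lemma gp_mulVg : left_inverse (gp_class [::]) gp_invg gp_mulg.
Proof.
move=> x; rewrite -{2}(gp_reprK x) gp_mulgE.
by apply/gp_classP; apply: word_invV.
Qed.

Lemma gp_mulgV : right_inverse (gp_class [::]) gp_invg gp_mulg.
Proof.
move=> x; rewrite -{1}(gp_reprK x) gp_mulgE.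
by apply/gp_classP; apply: wordVinv.
Qed.

HB.instance Definition _ := isGroup.Build graph_product
  gp_mulgA gp_mul1g gp_mulg1 gp_mulVg gp_mulgV.

Definition gp_in (i : 'I_n) (g : G i) : graph_product := gp_class [:: syl g].

Lemma gp_inM i (g h : G i) : gp_in (g * h) = gp_in g * gp_in h.
Proof.
apply/esym; rewrite /gp_in [LHS]gp_mulgE.
by apply/gp_classP; apply: gp_mul.
Qed.

Lemma gp_in_comm i j (g : G i) (h : G j) :
  adj i j -> gp_in g * gp_in h = gp_in h * gp_in g.
Proof.
move=> ij; rewrite [LHS]gp_mulgE [RHS]gp_mulgE.
by apply/gp_classP; apply: gp_comm.
Qed.

Lemma gp_class_prod u :
  gp_class u = \prod_(s <- u) gp_in (tagged s).
Proof.
elim: u => [|[i g] u IHu]; first by rewrite big_nil.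
by rewrite big_cons -IHu [RHS]gp_mulgE.
Qed.

Lemma gp_universal (H : groupType) (f : forall i, G i -> H) :
  (forall i (g h : G i), f i (g * h) = f i g * f i h) ->
  (forall i j (g : G i) (h : G j), adj i j -> f i g * f j h = f j h * f i g) ->
  exists! F : graph_product -> H,
    (forall x y, F (x * y) = F x * F y) /\ (forall i (g : G i), F (gp_in g) = f i g).
Proof.
move=> fM fC; pose E (u : seq syllable) := \prod_(s <- u) f (tag s) (tagged s).
have E_cat u v : E (u ++ v) = E u * E v by rewrite /E big_cat.
have EP u v : gp_eq u v -> E u = E v.
  elim=> [i g h|i|i j g h ij|//|//|u1 v1 w1 _ -> _ -> //|].
  - by rewrite /E !big_cons big_nil !mulg1 fM.
  - rewrite /E big_cons big_nil mulg1 /=.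
    by apply: (mulgI (f i 1)); rewrite mulg1 -fM mulg1.
  - by rewrite /E !big_cons big_nil !mulg1 /= fC.
  - by move=> u1 u2 v1 v2 _ e1 _ e2; rewrite !E_cat e1 e2.
exists (fun x => E (gp_repr x)); split.
  split=> [x y|i g].
    by rewrite -E_cat; apply: EP; apply: gp_repr_class.
  by rewrite (EP _ _ (gp_repr_class _)) /E big_cons big_nil mulg1.
move=> F [FM Fin]; apply/funext => x.
have F1 : F 1 = 1 by apply: (mulgI (F 1)); rewrite -FM !mulg1.
rewrite -{2}(gp_reprK x); elim: (gp_repr x) => [|[i g] u IHu].
  by rewrite /E big_nil -F1.
rewrite gp_class_prod big_cons FM Fin -gp_class_prod -IHu.
by rewrite /E big_cons.
Qed.

End GraphProduct.

Section GraphProductWords.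
Variables (n : nat) (adj : rel 'I_n) (G : 'I_n -> groupType).
Variable X : forall i : 'I_n, {fset G i}.

(* The disjoint union of the X i: letters from different X i are distinct. *)
Definition letter : Type := {i : 'I_n & X i}.
HB.instance Definition _ := Finite.on letter.

Definition ltr (i : 'I_n) (a : X i) : letter := Tagged (fun i => X i) a.

Definition vertex_ev (i : 'I_n) (a : X i) : G i := val a.

Definition letter_ev (a : letter) : graph_product adj G :=
  gp_in adj (vertex_ev (tagged a)).

Inductive op_x0 : seq letter -> seq letter -> Prop :=
| OpX0 i (y z : seq letter) (u w : seq (X i)) :
    eval (@vertex_ev i) u = eval (@vertex_ev i) w -> (size w < size u)%N ->
    op_x0 (y ++ map (@ltr i) u ++ z) (y ++ map (@ltr i) w ++ z).

Inductive op_x1 : seq letter -> seq letter -> Prop :=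
| OpX1 i (y z : seq letter) (u w : seq (X i)) :
    eval (@vertex_ev i) u = eval (@vertex_ev i) w -> size u = size w ->
    op_x1 (y ++ map (@ltr i) u ++ z) (y ++ map (@ltr i) w ++ z).

Inductive op_x2 : seq letter -> seq letter -> Prop :=
| OpX2 i j (y z : seq letter) (u : seq (X i)) (w : seq (X j)) :
    adj i j ->
    op_x2 (y ++ map (@ltr i) u ++ map (@ltr j) w ++ z)
          (y ++ map (@ltr j) w ++ map (@ltr i) u ++ z).

Definition op_x12 (y z : seq letter) : Prop := op_x1 y z \/ op_x2 y z.
Definition op_x012 (y z : seq letter) : Prop :=
  [\/ op_x0 y z, op_x1 y z | op_x2 y z].

Definition trimmed (y : seq letter) : Prop :=
  ~ exists y1 y2 z,
      [/\ reachable op_x012 y y1, op_x0 y1 y2 & reachable op_x012 y2 z].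

(* [None] plays the role of the letter $; [untag] returns its first argument
   unless [tag a = i]. *)
Definition proj_letter (i : 'I_n) (a : letter) : seq (option (X i)) :=
  untag (if adj i (tag a) then [::] else [:: None]) (fun b : X i => [:: Some b]) a.

Definition proj (i : 'I_n) (w : seq letter) : seq (option (X i)) :=
  flatten (map (proj_letter i) w).

(* Gamma_i, as a language over X_i with the extra letter $. *)
Definition vertex_geodesic (i : 'I_n) : set (seq (option (X i))) :=
  fun w => exists2 u : seq (X i), geodesic (@vertex_ev i) u & w = map Some u.

Definition dollar (i : 'I_n) : set (seq (option (X i))) :=
  fun w => w = [:: None].

Definition proj_language (i : 'I_n) : set (seq (option (X i))) :=
  lang_cat (@vertex_geodesic i)
    (lang_star (lang_cat (@dollar i) (@vertex_geodesic i))).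

Definition clique (S : {set 'I_n}) : bool :=
  [forall i in S, forall j in S, (i != j) ==> adj i j].

Definition vertex_letters (i : 'I_n) : {set letter} :=
  [set a : letter | tag a == i]%SET.

Definition is_clique_letter (t : {set letter}) : bool :=
  [&& t != finset.set0,
      clique [set i | t :&: vertex_letters i != finset.set0]%SET
    & [forall i, #|t :&: vertex_letters i|%SET <= 1]%N].

(* The alphabet T. *)
Definition clique_letter : Type := {t : {set letter} | is_clique_letter t}.
HB.instance Definition _ := SubFinite.on clique_letter.

(* Members of a list that are not in T are dropped; it is only used on lists
   over T and the empty set, where it reads the empty set as the empty word. *)
Definition clique_word (ts : seq {set letter}) : seq clique_letter :=
  pmap insub ts.

Definition embed (w : seq letter) : seq clique_letter :=
  clique_word [seq [set a]%SET | a <- w].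

(* t is in T or empty, and {a, t} is defined, i.e. a is not in t and adding it
   to t gives an element of T. *)
Definition joinable (a : letter) (t : {set letter}) : bool :=
  [&& (t == finset.set0) || is_clique_letter t, a \notin t
    & is_clique_letter (a |: t)%SET].

(* [:: {a_1, t_1}; ...; {a_k, t_k}], where k is the smaller of the two
   lengths. *)
Definition joins (i : 'I_n) (a : seq (X i)) (ts : seq {set letter}) :
    seq {set letter} :=
  [seq (ltr p.1 |: p.2)%SET | p <- zip a ts].

Definition all_joinable (i : 'I_n) (a : seq (X i)) (ts : seq {set letter}) :=
  all2 joinable (map (@ltr i) a) ts.

Section Rewriting.
Variable le : forall i : 'I_n, rel (X i).

Definition total_order_rel (i : 'I_n) : Prop :=
  [/\ reflexive (@le i), antisymmetric (@le i), transitive (@le i)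
    & total (@le i)].

Fixpoint lex_lt (i : 'I_n) (u v : seq (X i)) : bool :=
  match u, v with
  | a :: u', b :: v' => if a == b then lex_lt u' v' else le a b
  | [::], _ :: _ => true
  | _, [::] => false
  end.

Definition shortlex_lt (i : 'I_n) (u v : seq (X i)) : bool :=
  (size u < size v)%N || ((size u == size v) && lex_lt u v).

Inductive rule : seq clique_letter -> seq clique_letter -> Prop :=
| RuleR0 i (a b : seq (X i)) (ts : seq {set letter}) :
    all_joinable a ts -> (size b < size a)%N ->
    eval (@vertex_ev i) a = eval (@vertex_ev i) b ->
    rule (clique_word (joins a ts))
         (clique_word (joins b ts ++ drop (size b) ts))
| RuleR1 i (a b : seq (X i)) (ts : seq {set letter}) :
    all_joinable a ts -> size b = size a ->
    eval (@vertex_ev i) a = eval (@vertex_ev i) b -> shortlex_lt b a ->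
    rule (clique_word (joins a ts)) (clique_word (joins b ts))
| RuleR2 (a : letter) (t t' : {set letter}) :
    is_clique_letter t -> joinable a t -> joinable a t' ->
    rule (clique_word [:: t; a |: t']%SET) (clique_word [:: a |: t; t']%SET).

Inductive rewrite_step : seq clique_letter -> seq clique_letter -> Prop :=
| RewriteStep p l r q : rule l r -> rewrite_step (p ++ l ++ q) (p ++ r ++ q).

Definition irreducible (v : seq clique_letter) : Prop :=
  forall v', ~ rewrite_step v v'.

(* The system is terminating and confluent, so the set below is a singleton
   and [xget] picks its element; the default value is irrelevant. *)
Definition irr (w : seq letter) : seq clique_letter :=
  xget [::] (fun v => reachable rewrite_step (embed w) v /\ irreducible v).

Definition Theta (listing : clique_letter -> seq letter) (w : seq letter) :
    seq letter :=
  flatten (map listing (irr w)).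

End Rewriting.

End GraphProductWords.

(* Main.v *)
(* The implication (iii) => (i) rests on an action of the graph product on the
   tuples of projections of reduced syllable words.  In such a tuple the element
   g of G_i multiplies a G_i-syllable in front of the i-th projection, and is
   otherwise added to the front of all projections that see it; elements of
   adjacent groups touch disjoint data up to their $ signs, whence the action.
   The image of the empty tuple under an element gives the total length of its
   reduced syllables.  One letter raises it by at most one, and a word whose
   projections have geodesic blocks attains the bound.
   A trimmed word satisfies (iii) since shuffles bring any block of its i-th
   projection to the front.  Rules of R are simulated by (x0)-(x2), so a trimmed
   word reaches Theta by (x1) and (x2).  Finally, if v is irreducible, (R2) makes
   the letters of each block of the i-th projection of h(v) sit in consecutive
   sets and then (R0) makes the block geodesic, so h(v) is a geodesic by (iii).
   Termination of R is used, but confluence is not. *)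
Require Import Defs.
From Stdlib Require Import Relation_Operators.
From mathcomp Require Import all_boot finmap.
From mathcomp Require Import boolp.
From mathcomp Require Import zify.
From mathcomp Require classical_sets.

Set Implicit Arguments.
Unset Strict Implicit.
Unset Printing Implicit Defensive.

Local Open Scope group_scope.

Lemma untag_Tagged (I : eqType) (T : I -> Type) (R : Type) (idx : R) (i : I)
    (F : T i -> R) (x : T i) : untag idx F (Tagged T x) = F x.
Proof. by rewrite (@untagE _ _ _ idx i F (Tagged T x) erefl). Qed.

(** * The action of the graph product on tuples of projections *)

Section Traces.
Variables (n : nat) (adj : rel 'I_n) (G : 'I_n -> groupType).
Hypotheses (adj_sym : symmetric adj) (adj_irr : irreflexive adj).

(* The component [i] lists the [G i]-syllables of a word, with [None] in place of
   each syllable from another group not commuting with [G i]. *)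
Definition trace : Type := 'I_n -> seq (option (syllable G)).

Definition push (s : syllable G) (Q : trace) : trace := fun j =>
  if j == tag s then Some s :: Q j
  else if adj (tag s) j then Q j else None :: Q j.

(** Admitting a trivial syllable makes [reduced_split] uniform, whether or not component [i] starts
    with a syllable. *)
Definition push1 (s : syllable G) (Q : trace) : trace :=
  if tagged s == 1 then Q else push s Q.

(** Expresses that no [G i]-syllable of the underlying word can be shuffled to its front. *)
Definition blocked (i : 'I_n) (Q : trace) : bool :=
  if Q i is Some _ :: _ then false else true.

(** Components of reduced traces hold only syllables of their own group, so there the default of
    [untag] is never met. *)
Definition front (i : 'I_n) (Q : trace) : G i :=
  if Q i is Some s :: _ then untag 1 (fun g : G i => g) s else 1.

(** Removes the front [G i]-syllable together with the dollar signs it left elsewhere; component [i]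
    is also shortened, as [adj i i] is false. *)
Definition rest (i : 'I_n) (Q : trace) : trace :=
  if blocked i Q then Q else fun j => if adj i j then Q j else behead (Q j).

Definition act (s : syllable G) (Q : trace) : trace :=
  push1 (syl (tagged s * front (tag s) Q)) (rest (tag s) Q).

(** The traces of reduced words: each new syllable is nontrivial and cannot merge with one pushed
    earlier. *)
Inductive reduced : trace -> Prop :=
| reduced_nil : reduced (fun=> [::])
| reduced_push (s : syllable G) Q :
    reduced Q -> blocked (tag s) Q -> tagged s != 1 -> reduced (push s Q).

Lemma push_comm (s t : syllable G) Q :
  adj (tag s) (tag t) -> push s (push t Q) = push t (push s Q).
Proof.
move=> st; apply/funext => j; rewrite /push.
have [->|js] := eqVneq j (tag s).
  by case: eqVneq st => [->|_ st]; rewrite ?adj_irr // adj_sym st.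
by have [->|jt] := eqVneq j (tag t); [rewrite st | case: adj; case: adj].
Qed.

Lemma push1_comm (s t : syllable G) Q :
  adj (tag s) (tag t) -> push1 s (push1 t Q) = push1 t (push1 s Q).
Proof.
by move=> st; rewrite /push1; do 2!case: eqP => // _; apply: push_comm.
Qed.

Lemma blocked_push i (s : syllable G) Q :
  adj (tag s) i -> blocked i (push s Q) = blocked i Q.
Proof.
move=> si; rewrite /blocked /push si; case: eqVneq si => // ->.
by rewrite adj_irr.
Qed.

Lemma blocked_push1 i (s : syllable G) Q :
  adj (tag s) i -> blocked i (push1 s Q) = blocked i Q.
Proof. by rewrite /push1; case: ifP => // _; apply: blocked_push. Qed.

Lemma front_blocked i Q : blocked i Q -> front i Q = 1.
Proof. by rewrite /blocked /front; case: (Q i) => [|[]]. Qed.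

Lemma front_push1 i (g : G i) Q : blocked i Q -> front i (push1 (syl g) Q) = g.
Proof.
rewrite /push1; case: eqP => [/= -> /front_blocked // | _ _].
by rewrite /front /push eqxx untag_Tagged.
Qed.

Lemma rest_push1 i (g : G i) Q : blocked i Q -> rest i (push1 (syl g) Q) = Q.
Proof.
rewrite /push1; case: eqP => [_ iQ | _ _]; first by rewrite /rest iQ.
rewrite /rest.
have -> : blocked i (push (syl g) Q) = false by rewrite /blocked /push eqxx.
apply/funext => j; rewrite /push /=.
by case: eqVneq => [->|_]; rewrite ?adj_irr //; case: adj.
Qed.

(* The pushes following that of the first [i]-syllable commute with it, so that
   syllable may be pushed last instead. *)
Lemma reduced_unpush i Q : reduced Q -> ~~ blocked i Q ->
  exists g : G i, exists R,
    [/\ reduced R, blocked i R, g != 1 & Q = push (syl g) R].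
Proof.
move=> rQ; elim: rQ => {Q} [//|[k g] Q rQ IHQ /= kQ g1].
have [e|ki] := eqVneq i k; first by case: _ / (esym e) in g g1 kQ *; exists g, Q.
have [aki|aki] := boolP (adj k i); last first.
  by rewrite /blocked /push (negPf ki) (negPf aki).
rewrite blocked_push //= => /IHQ[h [R [rR iR h1 QE]]]; exists h.
exists (push (syl g) R); split=> //.
- apply: reduced_push => //.
  by move: kQ; rewrite QE blocked_push //= adj_sym.
- by rewrite blocked_push.
- by rewrite QE push_comm.
Qed.

(** A normal form relative to [i]: on [push1 (syl g) R] the group [G i] acts by left multiplication
    on [g] and leaves [R] alone, which reduces every law of the action to one in [G i]. *)
Lemma reduced_split i Q : reduced Q ->
  exists g : G i, exists R, [/\ Q = push1 (syl g) R, reduced R & blocked i R].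
Proof.
move=> rQ; have [iQ|/(reduced_unpush rQ)[g [R [rR iR g1 ->]]]] := boolP (blocked i Q).
  by exists 1, Q; rewrite /push1 eqxx.
by exists g, R; rewrite /push1 (negPf g1).
Qed.

Lemma reduced_push1 (s : syllable G) Q :
  reduced Q -> blocked (tag s) Q -> reduced (push1 s Q).
Proof. by rewrite /push1; case: ifPn => // *; apply: reduced_push. Qed.

Lemma act_push1 i (g h : G i) Q : blocked i Q ->
  act (syl g) (push1 (syl h) Q) = push1 (syl (g * h)) Q.
Proof. by move=> iQ; rewrite /act /= front_push1 ?rest_push1. Qed.

Lemma reduced_act (s : syllable G) Q : reduced Q -> reduced (act s Q).
Proof.
case: s => i g /(reduced_split i)[h [R [-> rR iR]]].
by rewrite act_push1 //; apply: reduced_push1.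
Qed.

Lemma actM i (g h : G i) Q :
  reduced Q -> act (syl g) (act (syl h) Q) = act (syl (g * h)) Q.
Proof.
by move=> /(reduced_split i)[a [R [-> _ iR]]]; rewrite !act_push1 // mulgA.
Qed.

Lemma act1 i Q : reduced Q -> act (syl (1 : G i)) Q = Q.
Proof.
by move=> /(reduced_split i)[a [R [-> _ iR]]]; rewrite act_push1 // mul1g.
Qed.

(** Splitting at [i] and then at [j] leaves a trace blocked at both vertices. The two commuting
    syllables in front of it are multiplied independently. *)
Lemma act_comm i j (g : G i) (h : G j) Q : adj i j -> reduced Q ->
  act (syl g) (act (syl h) Q) = act (syl h) (act (syl g) Q).
Proof.
move=> ij /(reduced_split i)[a [R [-> /(reduced_split j)[b [S [-> _ jS]]]]]].
have ji : adj j i by rewrite adj_sym.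
rewrite blocked_push1 // => iS.
have ab (a' : G i) (b' : G j) :
    push1 (syl a') (push1 (syl b') S) = push1 (syl b') (push1 (syl a') S).
  exact: push1_comm.
rewrite act_push1 ?blocked_push1 // !ab !act_push1 ?blocked_push1 // -ab.
by rewrite act_push1 ?blocked_push1.
Qed.

Lemma reduced_foldr u Q : reduced Q -> reduced (foldr act Q u).
Proof. by move=> rQ; elim: u => //= s u; apply: reduced_act. Qed.

(** The defining relations hold for the action, so the resulting trace depends only on the group
    element. *)
Lemma foldr_act_gp_eq u v : gp_eq adj u v ->
  forall Q, reduced Q -> foldr act Q u = foldr act Q v.
Proof.
elim=> {u v} [i g h|i|i j g h ij|//|u v _ IH|u v w _ IHu _ IHv
  |u u' v v' _ IHu _ IHv] Q rQ /=.
- exact: actM.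
- exact: act1.
- exact: act_comm.
- by rewrite IH.
- by rewrite IHu ?IHv.
- by rewrite !foldr_cat IHv // IHu //; apply: reduced_foldr.
Qed.

Section Weight.
Variable len : forall i, G i -> nat.
Hypothesis len1 : forall i, len (1 : G i) = 0.

(** Dollar signs count for nothing, so each syllable is counted once, in the component of its own
    group. *)
Definition weight (Q : trace) : nat :=
  \sum_i \sum_(o <- Q i) (if o is Some s then len (tagged s) else 0).

Lemma weight_push1 (s : syllable G) Q : weight (push1 s Q) = (len (tagged s) + weight Q)%N.
Proof.
rewrite /push1; case: eqP => [->|_]; first by rewrite len1.
rewrite /weight (bigD1 (tag s)) //= [in RHS](bigD1 (tag s)) //= addnA.
rewrite {1}/push eqxx big_cons; congr (_ + _)%N; apply: eq_bigr => j js.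
by rewrite /push (negPf js); case: ifP; rewrite ?big_cons.
Qed.

End Weight.
End Traces.

Arguments act [n] adj {G} s Q _.

(** * Word length and geodesic blocks *)

Section GeodesicWords.
Variables (K : groupType) (A : choiceType) (ev : A -> K).

Lemma eval_cons a u : eval ev (a :: u) = ev a * eval ev u.
Proof. by rewrite /eval big_cons. Qed.

Lemma eval_cat u v : eval ev (u ++ v) = eval ev u * eval ev v.
Proof. by rewrite /eval big_cat. Qed.

Lemma geodesic_nil : geodesic ev [::].
Proof. by []. Qed.

Lemma geodesic_behead a u : geodesic ev (a :: u) -> geodesic ev u.
Proof.
by move=> gu v uv; rewrite -(ltnS (size u)) (gu (a :: v)) // !eval_cons uv.
Qed.

Lemma not_geodesic u : ~ geodesic ev u ->
  exists2 v, eval ev u = eval ev v & (size v < size u)%N.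
Proof.
move=> ngu; apply: contrapT => nex; apply: ngu => v uv.
by rewrite leqNgt; apply/negP => vu; apply: nex; exists v.
Qed.

Lemma geodesic_cons_neq1 a u : geodesic ev (a :: u) -> ev a * eval ev u != 1.
Proof.
move=> gu; apply/eqP => e; have := gu [::].
by rewrite eval_cons e /eval big_nil => /(_ erefl).
Qed.

(** Elements that no word represents get length 0 from the default. *)
Definition wlen (g : K) : nat :=
  size (classical_sets.xget [::] (fun u : seq A => eval ev u = g /\ geodesic ev u)).

Lemma wlen_geodesic u : geodesic ev u -> wlen (eval ev u) = size u.
Proof.
move=> gu; rewrite /wlen; case: classical_sets.xgetP => [v _ [vu gv]|/(_ u)[]//].
by apply/eqP; rewrite eqn_leq gv // gu.
Qed.

Lemma wlen_le u : (wlen (eval ev u) <= size u)%N.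
Proof.
have [k] := ubnP (size u); elim: k u => // k IHk u.
have [/wlen_geodesic -> //|/not_geodesic[v -> vu]] := pselect (geodesic ev u).
by move=> uk; apply: leq_trans (ltnW vu); apply/IHk/(leq_trans vu).
Qed.

Lemma wlen1 : wlen 1 = 0%N.
Proof. by have := wlen_geodesic geodesic_nil; rewrite /eval big_nil. Qed.

(** The assumption on [g] excludes the default value of [wlen]; a representing word is shortened
    until it is geodesic. *)
Lemma wlen_mul a g : (exists u, eval ev u = g) ->
  (wlen (ev a * g) <= (wlen g).+1)%N.
Proof.
move=> [u <-]; have [k] := ubnP (size u); elim: k u => // k IHk u.
have [gu _|/not_geodesic[v -> vu] uk] := pselect (geodesic ev u).
  by rewrite (wlen_geodesic gu) -eval_cons; apply: wlen_le.
by apply/IHk/(leq_trans vu).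
Qed.

Fixpoint first_block (p : seq (option A)) : seq A :=
  if p is Some a :: p' then a :: first_block p' else [::].

(** A letter-by-letter form of the language in (iii), suited to induction. Every suffix of a block
    is tested, which is harmless since suffixes of geodesics are geodesics. *)
Fixpoint blocks_geodesic (p : seq (option A)) : Prop :=
  match p with
  | [::] => True
  | None :: p' => blocks_geodesic p'
  | Some a :: p' => geodesic ev (a :: first_block p') /\ blocks_geodesic p'
  end.

Lemma first_block_cat u p : first_block (map Some u ++ p) = u ++ first_block p.
Proof. by elim: u => //= a u ->. Qed.

Lemma blocks_geodesic_cat u p : first_block p = [::] -> blocks_geodesic p ->
  geodesic ev u -> blocks_geodesic (map Some u ++ p).
Proof.
move=> p0 bp; elim: u => //= a u IHu gu.
by rewrite first_block_cat p0 cats0; split=> //; apply/IHu/geodesic_behead/gu.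
Qed.

End GeodesicWords.

Lemma generates_words (K : groupType) (Y : {fset K}) (g : K) :
  generates Y -> inverse_closed Y -> exists u : seq Y, eval (fun a => val a) u = g.
Proof.
move=> Yg Yi; have [s [sY ->]] := Yg g.
elim: s sY => [|x s IHs] sY; first by exists [::]; rewrite /eval !big_nil.
have xY : x \in Y.
  by have [//|/Yi] := sY x (mem_head x s); rewrite invgK.
have [|u eu] := IHs; first by move=> z zs; apply: sY; rewrite inE zs orbT.
by exists ([` xY]%fset :: u); rewrite eval_cons eu big_cons.
Qed.

(** * The projections and the language of (iii) *)

Section Projections.
Variables (n : nat) (adj : rel 'I_n) (G : 'I_n -> groupType).
Variable X : forall i : 'I_n, {fset G i}.

Local Notation vev i := (@vertex_ev n G X i).

Lemma proj_languageP i (p : seq (option (X i))) :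
  proj_language p <-> blocks_geodesic (vev i) p.
Proof.
split.
  case=> _ [v [[u gu ->] vL ->]].
  suff [v0 bv] : first_block v = [::] /\ blocks_geodesic (vev i) v.
    exact: blocks_geodesic_cat.
  elim: vL => // _ {}v [_ [_ [-> [w gw ->] ->]]] _ [v0 bv] /=.
  by split=> //; apply: blocks_geodesic_cat.
(* Cut [p] after its first block; the remainder is empty or starts with a dollar sign, and lies in
   the star. *)
move=> bp; suff [v vL pE] : exists2 v,
    lang_star (lang_cat (@dollar _ _ _ i) (@vertex_geodesic _ _ X i)) v
    & p = map Some (first_block p) ++ v.
  rewrite {}pE; exists (map Some (first_block p)), v; split=> //.
  exists (first_block p) => //.
  by case: p bp => [|[a|] p]; [| case |] => //= *; apply: geodesic_nil.
elim: p bp => [_|[a|] p IHp] /=.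
- by exists [::] => //; apply: lang_star_nil.
- by move=> [_ /IHp[v vL pE]]; exists v => //; rewrite -pE.
move=> bp; have [v vL pE] := IHp bp; exists (None :: p) => //; rewrite pE.
rewrite -cat_cons; apply: lang_star_cat => //.
exists [:: None], (map Some (first_block p)); split=> //.
exists (first_block p) => //.
by case: p bp {IHp pE} => [|[a|] p]; [| case |] => //= *; apply: geodesic_nil.
Qed.

Lemma letter_tagP i (a : letter X) : (exists b : X i, a = ltr b) \/ tag a != i.
Proof.
case: a => j b; have [e|] := eqVneq j i; last by right.
by left; case: _ / e; exists b.
Qed.

Lemma proj_letter_ltr i (a : X i) : proj_letter adj i (ltr a) = [:: Some a].
Proof. by rewrite /proj_letter untag_Tagged. Qed.

Lemma proj_letter_neq i (a : letter X) : tag a != i ->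
  proj_letter adj i a = if adj i (tag a) then [::] else [:: None].
Proof. by move=> ai; rewrite /proj_letter untag_dflt. Qed.

Lemma proj_ltr i (a : X i) w : proj adj i (ltr a :: w) = Some a :: proj adj i w.
Proof. by rewrite /proj /= proj_letter_ltr. Qed.

Lemma proj_neq i (a : letter X) w : tag a != i ->
  proj adj i (a :: w) =
    if adj i (tag a) then proj adj i w else None :: proj adj i w.
Proof. by move=> ai; rewrite /proj /= proj_letter_neq //; case: ifP. Qed.

Lemma proj_cat i (u w : seq (letter X)) :
  proj adj i (u ++ w) = proj adj i u ++ proj adj i w.
Proof. by rewrite /proj map_cat flatten_cat. Qed.

Lemma blocks_geodesic_behead i (a : letter X) w :
  blocks_geodesic (vev i) (proj adj i (a :: w)) ->
  blocks_geodesic (vev i) (proj adj i w).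
Proof.
have [[b ->]|ai] := letter_tagP i a; first by rewrite proj_ltr => -[].
by rewrite proj_neq //; case: ifP.
Qed.

End Projections.

(** * Words with geodesic blocks are geodesic: (iii) implies (i) *)

Section GeodesicsOfGraphProduct.
Variables (n : nat) (adj : rel 'I_n) (G : 'I_n -> groupType).
Variable X : forall i : 'I_n, {fset G i}.
Hypotheses (adj_sym : symmetric adj) (adj_irr : irreflexive adj).
Hypothesis X_gen : forall i : 'I_n, generates (X i).
Hypothesis X_inv : forall i : 'I_n, inverse_closed (X i).

Local Notation vev i := (@vertex_ev n G X i).
Local Notation glen := (fun i => wlen (vev i)).

Definition syllables (w : seq (letter X)) : seq (syllable G) :=
  [seq syl (vertex_ev (tagged a)) | a <- w].

Lemma eval_letter_ev w : eval (@letter_ev n adj G X) w = gp_class adj (syllables w).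
Proof. by rewrite gp_class_prod /eval big_map. Qed.

Definition trace_of (w : seq (letter X)) : trace G :=
  foldr (act adj) (fun=> [::]) (syllables w).

Lemma reduced_trace_of w : reduced adj (trace_of w).
Proof. by apply: reduced_foldr => //; apply: reduced_nil. Qed.

Lemma trace_of_eval w w' :
  eval (@letter_ev n adj G X) w = eval (@letter_ev n adj G X) w' ->
  trace_of w = trace_of w'.
Proof.
rewrite !eval_letter_ev => /gp_classP e.
by apply: (foldr_act_gp_eq _ _ e) => //; apply: reduced_nil.
Qed.

Lemma glen1 i : glen i (1 : G i) = 0%N.
Proof. exact: wlen1. Qed.

(** By [reduced_split], a letter of [X i] changes a single syllable, by left multiplication with a
    generator. *)
Lemma weight_trace_le w : (weight glen (trace_of w) <= size w)%N.
Proof.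
elim: w => [|[i a] w IHw] /=.
  by rewrite /weight big1 // => i _; rewrite big_nil.
have [g [R [QE rR iR]]] := reduced_split adj_sym adj_irr i (reduced_trace_of w).
move: IHw; rewrite /trace_of /= -/(trace_of w) QE act_push1 //.
rewrite (weight_push1 _ glen1) (weight_push1 _ glen1) /= => IHw.
have ag : (wlen (vev i) (vev i a * g) <= (wlen (vev i) g).+1)%N.
  by apply: wlen_mul; apply: generates_words (@X_gen i) (@X_inv i).
by apply: leq_trans (leq_add ag (leqnn _)) _; rewrite addSn.
Qed.

Lemma front_push1_adj i (s : syllable G) Q :
  adj (tag s) i -> front i (push1 adj s Q) = front i Q.
Proof.
rewrite /push1 /front /push => si; case: ifP => // _.
by rewrite si; case: eqVneq si => // ->; rewrite adj_irr.
Qed.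

(** The claim about [front] is carried through the induction because it tells which syllable the
    next letter lengthens. *)
Lemma weight_trace_geodesic w :
  (forall i, blocks_geodesic (vev i) (proj adj i w)) ->
  weight glen (trace_of w) = size w /\
  forall i, front i (trace_of w) = eval (vev i) (first_block (proj adj i w)).
Proof.
elim: w => [|[i a] w IHw] bw.
  split=> [|i]; last by rewrite /eval big_nil.
  by rewrite /weight big1 // => i _; rewrite big_nil.
have [|IHs IHf] := IHw; first by move=> j; apply/blocks_geodesic_behead/bw.
have [g [R [QE rR iR]]] := reduced_split adj_sym adj_irr i (reduced_trace_of w).
have gE : g = eval (vev i) (first_block (proj adj i w)).
  by rewrite -IHf QE front_push1.
have := bw i; rewrite proj_ltr /= => -[ga _].
have trE : trace_of (Tagged _ a :: w) = push1 adj (syl (vertex_ev a * g)) R.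
  by rewrite /trace_of /= -/(trace_of w) QE act_push1.
have agE : vertex_ev a * g = eval (vev i) (a :: first_block (proj adj i w)).
  by rewrite eval_cons gE.
split.
  (* Both blocks are geodesic, so the lengths of their values differ by exactly one. *)
  have la : wlen (vev i) (vertex_ev a * g) = (wlen (vev i) g).+1.
    by rewrite agE gE (wlen_geodesic ga) (wlen_geodesic (geodesic_behead ga)).
  move: IHs; rewrite trE QE (weight_push1 _ glen1) (weight_push1 _ glen1) => <-.
  by rewrite -addSn; congr (_ + _)%N; apply: la.
move=> j; rewrite trE; have [e|ij] := eqVneq i j.
  by case: _ / e; rewrite front_push1 // agE proj_ltr.
rewrite proj_neq //; case: ifPn => /= ji.
  rewrite front_push1_adj; last by rewrite adj_sym.
  rewrite -IHf QE front_push1_adj //.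
  by rewrite adj_sym.
(* A nonempty geodesic has nontrivial value, so the push really puts a dollar sign in front of
   component [j]. *)
have ag1 : vertex_ev a * g != 1 by rewrite agE eval_cons; apply: geodesic_cons_neq1 ga.
rewrite [RHS]big_nil /push1 (negPf ag1).
by rewrite /front /push /= eq_sym (negPf ij) adj_sym (negPf ji).
Qed.

(** The weight of the trace is an invariant of the group element, bounded by the length of every
    word for it and equal to the length of [w]. *)
Lemma proj_geodesic w : (forall i, proj_language (proj adj i w)) ->
  geodesic (@letter_ev n adj G X) w.
Proof.
move=> wL w' /trace_of_eval e.
have [|<- _] := @weight_trace_geodesic w; first by move=> i; apply/proj_languageP.
by rewrite -e weight_trace_le.
Qed.

End GeodesicsOfGraphProduct.

(** * Reachability and lexicographic termination *)

Section Reachability.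
Variables (S T : Type) (r : S -> S -> Prop) (r' : T -> T -> Prop).

Lemma reachable_map (f : S -> T) :
  (forall x y, r x y -> reachable r' (f x) (f y)) ->
  forall x y, reachable r x y -> reachable r' (f x) (f y).
Proof.
move=> rr' x y; elim=> {x y} [x y /rr' //|x|x y z _ xy _ yz].
- exact: rt_refl.
- exact: rt_trans xy yz.
Qed.

Lemma reachable_invariant (P : S -> Prop) :
  (forall x y, r x y -> P x -> P y) ->
  forall x y, reachable r x y -> P x -> P y.
Proof. by move=> rP x y; elim=> {x y} [x y /rP||x y z _ xy _ yz /xy/yz]. Qed.

Lemma reachable_sym :
  (forall x y, r x y -> r y x) -> forall x y, reachable r x y -> reachable r y x.
Proof.
move=> rs x y; elim=> {x y} [x y /rs|x|x y z _ xy _ yz].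
- exact: rt_step.
- exact: rt_refl.
- exact: rt_trans yz xy.
Qed.

(** Nested inductions on bounds for [f], [g] and [h]: when an outer measure drops, the inner ones
    are unconstrained again. *)
Lemma lex_terminating (f g h : S -> nat) :
  (forall x y, r x y -> (f y < f x)%N \/ f y = f x /\
    ((g y < g x)%N \/ g y = g x /\ (h y < h x)%N)) ->
  forall x, exists2 y, reachable r x y & forall z, ~ r y z.
Proof.
move=> rfgh x.
have [k1] := ubnP (f x); elim: k1 x => // k1 IH1 x fx.
have [k2] := ubnP (g x); elim: k2 x fx => // k2 IH2 x fx gx.
have [k3] := ubnP (h x); elim: k3 x fx gx => // k3 IH3 x fx gx hx.
have [[z xz]|nex] := pselect (exists z, r x z); last first.
  by exists x => [|z xz]; [apply: rt_refl | apply: nex; exists z].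
suff [y zy ny] : exists2 y, reachable r z y & forall z, ~ r y z.
  by exists y => //; apply: rt_trans zy; apply: rt_step.
case: (rfgh x z xz) => [fz|[fz [gz|[gz hz]]]].
- by apply: IH1; apply: leq_trans fz _.
- by apply: IH2; [rewrite fz | apply: leq_trans gz _].
- by apply: IH3; [rewrite fz | rewrite gz | apply: leq_trans hz _].
Qed.

End Reachability.

(** * The operations (x0)-(x2) and trimmed words *)

Section Operations.
Variables (n : nat) (adj : rel 'I_n) (G : 'I_n -> groupType).
Variable X : forall i : 'I_n, {fset G i}.
Hypotheses (adj_sym : symmetric adj) (adj_irr : irreflexive adj).

Implicit Types (u v w y z p q : seq (letter X)) (a b : letter X).

Local Notation vev i := (@vertex_ev n G X i).
Local Notation lev := (@letter_ev n adj G X).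
Local Notation reach12 := (reachable (op_x12 adj (X := X))).
Local Notation reach012 := (reachable (op_x012 adj (X := X))).

Lemma op_x0_context p q u v : op_x0 u v -> op_x0 (p ++ u ++ q) (p ++ v ++ q).
Proof.
case=> i y z s t e st; rewrite -!catA ![p ++ y ++ _]catA.
by apply: OpX0.
Qed.

Lemma op_x1_context p q u v : op_x1 u v -> op_x1 (p ++ u ++ q) (p ++ v ++ q).
Proof.
case=> i y z s t e st; rewrite -!catA ![p ++ y ++ _]catA.
by apply: OpX1.
Qed.

Lemma op_x2_context p q u v :
  op_x2 adj u v -> op_x2 adj (p ++ u ++ q) (p ++ v ++ q).
Proof.
case=> i j y z s t ij; rewrite -!catA ![p ++ y ++ _]catA.
by apply: OpX2.
Qed.

Lemma reach12_context p q u v : reach12 u v -> reach12 (p ++ u ++ q) (p ++ v ++ q).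
Proof.
apply: (reachable_map (f := fun w => p ++ w ++ q)) => {}u {}v uv.
apply: rt_step; case: uv => uv; [left | right].
  exact: op_x1_context.
exact: op_x2_context.
Qed.

Lemma reach012_context p q u v :
  reach012 u v -> reach012 (p ++ u ++ q) (p ++ v ++ q).
Proof.
apply: (reachable_map (f := fun w => p ++ w ++ q)) => {}u {}v uv.
apply: rt_step; case: uv => uv; [apply: Or31 | apply: Or32 | apply: Or33].
- exact: op_x0_context.
- exact: op_x1_context.
- exact: op_x2_context.
Qed.

Lemma reach12_sym u v : reach12 u v -> reach12 v u.
Proof.
apply: reachable_sym => {}u {}v [[i y z s t e st]|[i j y z s t ij]].
  by left; apply: OpX1.
by right; apply: OpX2; rewrite adj_sym.
Qed.

Lemma reach12_012 u v : reach12 u v -> reach012 u v.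
Proof.
apply: (reachable_map (f := id)) => {}u {}v uv.
by apply: rt_step; case: uv; [apply: Or32 | apply: Or33].
Qed.

Lemma reach12_cat u u' v v' :
  reach12 u u' -> reach12 v v' -> reach12 (u ++ v) (u' ++ v').
Proof.
move=> uu' vv'; apply: rt_trans (reach12_context [::] v uu') _.
by have := reach12_context u' [::] vv'; rewrite !cats0.
Qed.

Lemma eval_map_ltr i (s : seq (X i)) :
  eval lev (map (@ltr n G X i) s) = gp_in adj (eval (vev i) s).
Proof.
elim: s => [|a s IHs]; last by rewrite /= !eval_cons IHs -gp_inM.
rewrite /eval !big_nil; apply: (mulgI (gp_in adj (1 : G i))).
by rewrite mulg1 -gp_inM mulg1.
Qed.

Lemma op_x0_eval_size u v : op_x0 u v ->
  eval lev v = eval lev u /\ (size v < size u)%N.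
Proof.
case=> i y z s t e st; rewrite !eval_cat !eval_map_ltr e; split=> //.
by rewrite !size_cat !size_map ltn_add2l ltn_add2r.
Qed.

Lemma op_x12_eval_size u v : op_x12 adj u v ->
  eval lev v = eval lev u /\ size v = size u.
Proof.
case=> [[i y z s t e st]|[i j y z s t ij]].
  by rewrite !eval_cat !eval_map_ltr e !size_cat !size_map st.
split; last by rewrite !size_cat; congr (_ + _)%N; rewrite addnCA.
by rewrite !eval_cat !eval_map_ltr; congr (_ * _); rewrite !mulgA (gp_in_comm _ _ ij).
Qed.

Lemma reach12_eval_size u v : reach12 u v ->
  eval lev v = eval lev u /\ size v = size u.
Proof.
pose P v := eval lev v = eval lev u /\ size v = size u.
move=> uv; apply: (reachable_invariant (P := P) _ uv) => // {uv}v w.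
by move=> /op_x12_eval_size[evw svw]; rewrite /P evw svw.
Qed.

Lemma reach012_eval_size u v : reach012 u v ->
  eval lev v = eval lev u /\ (size v <= size u)%N.
Proof.
pose P v := eval lev v = eval lev u /\ (size v <= size u)%N.
move=> uv; apply: (reachable_invariant (P := P) _ uv) => // {uv}v w vw [ev sv].
have [evw svw] : eval lev w = eval lev v /\ (size w <= size v)%N.
  case: vw => [/op_x0_eval_size[-> /ltnW //]|vw|vw].
    by have [-> ->] := op_x12_eval_size (or_introl vw).
  by have [-> ->] := op_x12_eval_size (or_intror vw).
by rewrite /P evw; split=> //; apply: leq_trans svw sv.
Qed.

(** All operations preserve the element and none lengthens the word, while (x0) shortens it. *)
Lemma geodesic_trimmed y : geodesic lev y -> trimmed adj y.
Proof.
move=> gy [y1 [y2 [z [/reach012_eval_size[e1 s1] /op_x0_eval_size[e2 s2] _]]]].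
by have := gy y2; rewrite e2 e1 leqNgt (leq_trans s2 s1) => /(_ erefl).
Qed.

Lemma trimmed_reach12 y z : trimmed adj y -> reach012 y z -> reach12 y z.
Proof.
(* The invariant also keeps [reach012 y z], since trimmedness speaks of mixed sequences starting at
   [y]. *)
move=> ty yz; pose P z := reach012 y z /\ reach12 y z.
suff [//] : P z.
apply: (reachable_invariant (P := P) _ yz); last by split; apply: rt_refl.
move=> {yz}z w zw [yz0 yz]; split.
  by apply: rt_trans yz0 _; apply: rt_step.
apply: rt_trans yz _; apply: rt_step; case: zw => [zw||]; [|by left|by right].
by case: ty; exists z, w, w; split=> //; apply: rt_refl.
Qed.

Lemma trimmed_behead a y : trimmed adj (a :: y) -> trimmed adj y.
Proof.
move=> ty [y1 [y2 [z [yy1 y12 _]]]]; apply: ty.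
exists (a :: y1), (a :: y2), (a :: y2); split; last exact: rt_refl.
  by have := reach012_context [:: a] [::] yy1; rewrite !cats0.
by have := op_x0_context [:: a] [::] y12; rewrite !cats0.
Qed.

(** One shuffle exchanges words over single vertex sets only; mixed words are exchanged letter by
    letter. *)
Lemma reach12_swap u v :
  (forall a b, a \in u -> b \in v -> adj (tag a) (tag b)) ->
  reach12 (u ++ v) (v ++ u).
Proof.
have swap1 a b : adj (tag a) (tag b) -> reach12 [:: a; b] [:: b; a].
  case: a b => [i a] [j b] /= ij; apply: rt_step; right.
  exact: (@OpX2 n adj G X i j [::] [::] [:: a] [:: b]).
have swap a w : (forall b, b \in w -> adj (tag a) (tag b)) ->
    reach12 (a :: w) (rcons w a).
  elim: w => [|b w IHw] aw; first exact: rt_refl.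
  have /(reach12_context [::] w) ab := swap1 a b (aw b (mem_head b w)).
  apply: rt_trans ab _.
  apply: (@reach12_cat [:: b] [:: b] (a :: w) (rcons w a)); first exact: rt_refl.
  by apply: IHw => c cw; apply: aw; rewrite inE cw orbT.
elim: u => [|a u IHu] uv; first by rewrite cats0; apply: rt_refl.
apply: (@rt_trans _ _ _ ([:: a] ++ (v ++ u))).
  apply: (@reach12_cat [:: a] [:: a]); first exact: rt_refl.
  by apply: IHu => b c bu; apply: uv; rewrite inE bu orbT.
rewrite catA -[v ++ _ :: _]cat_rcons; apply: reach12_cat (rt_refl _ _ _).
by apply: swap => b; apply: uv; apply: mem_head.
Qed.

(** Makes the choice of listing of a clique immaterial up to shuffles. *)
Lemma reach12_perm u v : perm_eq u v -> uniq u ->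
  {in u &, forall a b, a != b -> adj (tag a) (tag b)} -> reach12 u v.
Proof.
elim: v u => [|a v IHv] u uv; first by rewrite (perm_nilP uv) => *; apply: rt_refl.
have au : a \in u by rewrite (perm_mem uv) mem_head.
case/splitPr: au uv => u1 u2 uv.
rewrite cat_uniq /= => /and4P[U1 /norP[au1 d12] _ U2] cu.
have {}uv : perm_eq (u1 ++ u2) v.
  by move: uv; rewrite -[a :: u2]cat1s perm_catCA perm_cons.
apply: (@rt_trans _ _ _ (a :: (u1 ++ u2))).
  rewrite -cat_rcons -cats1 -!cat_cons; apply: reach12_cat (rt_refl _ _ _).
  apply: (@reach12_swap u1 [:: a]) => b c bu1; rewrite inE => /eqP ->.
  apply: cu; rewrite ?mem_cat ?inE ?bu1 ?eqxx ?orbT //.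
  by apply: contraNneq au1 => <-.
rewrite -[a :: v]cat1s -[a :: _]cat1s; apply: reach12_cat; first exact: rt_refl.
apply: IHv => //; first by rewrite cat_uniq U1 d12.
move=> b c bu bc; apply: cu.
  by move: bu; rewrite !mem_cat inE => /orP[] ->; rewrite ?orbT.
by move: bc; rewrite !mem_cat inE => /orP[] ->; rewrite ?orbT.
Qed.

(** The letters of [y] interspersed in the block are erased by the projection, hence adjacent to
    [i], and the block can be gathered in front of them. *)
Lemma reach12_first_block i y : exists z,
  reach12 y (map (@ltr n G X i) (first_block (proj adj i y)) ++ z).
Proof.
elim: y => [|a y [z yz]]; first by exists [::]; apply: rt_refl.
have [[b ->]|ai] := letter_tagP i a.
  exists z; rewrite proj_ltr /=.
  by apply: (@reach12_cat [:: ltr b] [:: ltr b]) => //; apply: rt_refl.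
rewrite proj_neq //; case: ifPn => [aia|_]; last by exists (a :: y); apply: rt_refl.
exists (a :: z); apply: (@rt_trans _ _ _ ([:: a] ++ _)).
  by apply: (@reach12_cat [:: a] [:: a] _ _ _ yz); apply: rt_refl.
rewrite -[a :: z]cat1s !catA; apply: reach12_cat (rt_refl _ _ _).
apply: reach12_swap => b c; rewrite inE => /eqP -> /mapP[d _ ->].
by rewrite adj_sym.
Qed.

(** (ii) implies (iii): once gathered at the front, a block that is not geodesic admits (x0). *)
Lemma trimmed_blocks_geodesic i y :
  trimmed adj y -> blocks_geodesic (vev i) (proj adj i y).
Proof.
elim: y => // a y IHy ty; have {IHy} := IHy (trimmed_behead ty).
have [[b ab]|ai] := letter_tagP i a; last by rewrite proj_neq //; case: ifP.
rewrite ab proj_ltr /=; split=> //; apply: contrapT => /not_geodesic[w ew sw].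
have [z yz] := reach12_first_block i (a :: y).
apply: ty; eexists; exists (map (@ltr n G X i) w ++ z), (map (@ltr n G X i) w ++ z).
split; [exact: reach12_012 yz| |exact: rt_refl].
rewrite ab proj_ltr.
exact: (@OpX0 n G X i [::] z (b :: first_block (proj adj i y)) w ew sw).
Qed.

End Operations.

(** * The alphabet T and the simulation of the rules by operations *)

Section CliqueLetters.
Variables (n : nat) (adj : rel 'I_n) (G : 'I_n -> groupType).
Variable X : forall i : 'I_n, {fset G i}.
Hypotheses (adj_sym : symmetric adj) (adj_irr : irreflexive adj).
Variable listing : clique_letter adj X -> seq (letter X).
Hypothesis listingP :
  forall t : clique_letter adj X, perm_eq (listing t) (enum (val t)).

Implicit Types (a b : letter X) (t : {set letter X}) (ts : seq {set letter X}).

Local Notation reach12 := (reachable (op_x12 adj (X := X))).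
Local Notation reach012 := (reachable (op_x012 adj (X := X))).

Definition clique_set t : bool :=
  [forall a in t, forall b in t, (a != b) ==> adj (tag a) (tag b)].

Definition link_clique (i : 'I_n) t : bool :=
  clique_set t && [forall b in t, adj i (tag b)].

Lemma clique_setP t :
  reflect {in t &, forall a b, a != b -> adj (tag a) (tag b)} (clique_set t).
Proof.
apply: (iffP forall_inP) => [ct a b ta tb ab|ct a ta].
  by have /forall_inP/(_ b tb)/implyP := ct a ta; apply.
by apply/forall_inP => b tb; apply/implyP; apply: ct.
Qed.

Lemma clique_set0 : clique_set finset.set0.
Proof. by apply/clique_setP => a b; rewrite inE. Qed.

(** Since [adj] is irreflexive, pairwise adjacency of distinct letters already forces at most one
    letter per vertex. *)
Lemma is_clique_letterE t :
  is_clique_letter adj t = (t != finset.set0) && clique_set t.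
Proof.
rewrite /is_clique_letter; congr (_ && _); apply/andP/clique_setP.
  move=> [/forall_inP cl /forallP card1] a b ta tb ab.
  have inS c : c \in t ->
      tag c \in [set i | t :&: vertex_letters X i != finset.set0]%SET.
    by move=> tc; rewrite inE; apply/set0Pn; exists c; rewrite !inE tc eqxx.
  have /forall_inP/(_ _ (inS b tb))/implyP := cl _ (inS a ta); apply.
  apply: contraNneq ab => tab; apply/eqP.
  by apply: (card_le1_eqP (card1 (tag b))); rewrite !inE ?ta ?tb ?tab eqxx.
move=> ct; split.
  apply/forall_inP => i; rewrite inE => /set0Pn[a].
  rewrite !inE => /andP[ta /eqP <-]; apply/forall_inP => j.
  rewrite inE => /set0Pn[b]; rewrite !inE => /andP[tb /eqP <-].
  by apply/implyP => ab; apply: ct => //; apply: contraNneq ab => ->.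
apply/forallP => i; apply/card_le1_eqP => a b; rewrite !inE.
move=> /andP[ta /eqP ai] /andP[tb /eqP bi]; apply/eqP/negPn/negP => ab.
by have := ct _ _ tb ta ab; rewrite ai bi adj_irr.
Qed.

Lemma clique_letter_set (t : clique_letter adj X) : clique_set (val t).
Proof. by have := valP t; rewrite is_clique_letterE => /andP[]. Qed.

Lemma link_cliqueU1 i (a : X i) t :
  link_clique i t -> is_clique_letter adj (ltr a |: t)%SET.
Proof.
move=> /andP[/clique_setP ct /forall_inP it]; rewrite is_clique_letterE.
apply/andP; split; first by apply/set0Pn; exists (ltr a); rewrite !inE eqxx.
apply/clique_setP => b c; rewrite !inE.
case/predU1P=> [->|tb] /predU1P[->|tc] bc //; first by rewrite eqxx in bc.
- exact: it.
- by rewrite adj_sym; apply: it.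
- exact: ct.
Qed.

Lemma link_clique_notin i (a : X i) t : link_clique i t -> ltr a \notin t.
Proof.
move=> /andP[_ /forall_inP it]; apply/negP => /it.
by rewrite /= adj_irr.
Qed.

(** Joinability depends only on the vertex of the letter, so both sides of a rule are defined
    together. *)
Lemma joinable_ltr i (a : X i) t : joinable adj (ltr a) t = link_clique i t.
Proof.
apply/idP/idP => [/and3P[ct at_ cat]|it].
  apply/andP; split.
    case/orP: ct => [/eqP ->|]; first exact: clique_set0.
    by rewrite is_clique_letterE => /andP[].
  move: cat; rewrite is_clique_letterE => /andP[_ /clique_setP cat].
  apply/forall_inP => b tb; apply: (cat (ltr a) b); rewrite ?inE ?eqxx ?tb ?orbT //.
  by apply: contraNneq at_ => ->.
apply/and3P; split; [|exact: link_clique_notin|exact: link_cliqueU1].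
by rewrite is_clique_letterE; case: eqP => //= _; case/andP: it.
Qed.

Lemma all_joinableE i (s : seq (X i)) ts :
  all_joinable adj s ts = (size s == size ts) && all (link_clique i) ts.
Proof.
rewrite /all_joinable; elim: s ts => [|a s IHs] [|t ts] //=.
by rewrite joinable_ltr IHs eqSS andbCA.
Qed.

(** A counterpart of [flat_listing] for lists of sets that may be empty, as they occur in the
    rules. *)
Definition flat_enum ts : seq (letter X) :=
  flatten [seq enum t | t : {set letter X} <- ts].

Definition flat_listing (v : seq (clique_letter adj X)) : seq (letter X) :=
  flatten (map listing v).

Lemma flat_listing_cat v1 v2 :
  flat_listing (v1 ++ v2) = flat_listing v1 ++ flat_listing v2.
Proof. by rewrite /flat_listing map_cat flatten_cat. Qed.

Lemma clique_word_cons t ts (ct : is_clique_letter adj t) :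
  clique_word adj (t :: ts) = Sub t ct :: clique_word adj ts.
Proof. by rewrite /clique_word /= (insubT (@is_clique_letter n adj G X)). Qed.

Lemma clique_word_skip t ts : ~~ is_clique_letter adj t ->
  clique_word adj (t :: ts) = clique_word adj ts.
Proof. by move=> ct; rewrite /clique_word /= insubN. Qed.

Lemma reach12_clique_word ts : all clique_set ts ->
  reach12 (flat_listing (clique_word adj ts)) (flat_enum ts).
Proof.
elim: ts => [_|t ts IHts /andP[ct cts]]; first exact: rt_refl.
have [t0|t0] := eqVneq t finset.set0.
  rewrite clique_word_skip; last by rewrite is_clique_letterE t0 eqxx.
  by rewrite /flat_enum /= t0 enum_set0; apply: IHts.
have clt : is_clique_letter adj t by rewrite is_clique_letterE t0.
rewrite clique_word_cons; apply: reach12_cat (IHts cts).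
have Pt := listingP (Sub t clt); rewrite SubK in Pt.
apply: reach12_perm => //; first by rewrite (perm_uniq Pt) enum_uniq.
move=> a b; rewrite !(perm_mem Pt) !mem_enum; exact/clique_setP.
Qed.

Lemma link_clique_set i ts : all (link_clique i) ts -> all clique_set ts.
Proof. by apply: sub_all => t /andP[]. Qed.

Lemma joins_clique_set i (s : seq (X i)) ts :
  all (link_clique i) ts -> all clique_set (joins s ts).
Proof.
rewrite /joins; elim: s ts => [|a s IHs] [|t ts] //= /andP[it its].
rewrite IHs // andbT; have := link_cliqueU1 a it.
by rewrite is_clique_letterE => /andP[].
Qed.

Lemma flat_enum_adj i b ts :
  all (link_clique i) ts -> b \in flat_enum ts -> adj i (tag b).
Proof.
move=> /allP its /flattenP[_ /mapP[t tts ->]]; rewrite mem_enum.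
by case/andP: (its t tts) => _ /forall_inP/(_ b).
Qed.

Lemma reach12_enumU1 i (a : X i) t : link_clique i t ->
  reach12 (enum (ltr a |: t)%SET) (ltr a :: enum t).
Proof.
move=> it; have at_ := link_clique_notin a it.
have := link_cliqueU1 a it; rewrite is_clique_letterE => /andP[_ /clique_setP ct].
apply: reach12_perm => //.
- apply: uniq_perm; rewrite /= ?enum_uniq ?mem_enum ?at_ // => b.
  by rewrite inE !mem_enum !inE.
- exact: enum_uniq.
- by move=> b c; rewrite !mem_enum; apply: ct.
Qed.

(** The letters of [s] move left past the sets, all of whose letters are adjacent to [i]. A short
    [s] covers the right-hand side of (R0). *)
Lemma reach12_joins i (s : seq (X i)) ts :
  (size s <= size ts)%N -> all (link_clique i) ts ->
  reach12 (flat_enum (joins s ts ++ drop (size s) ts))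
          (map (@ltr n G X i) s ++ flat_enum ts).
Proof.
elim: s ts => [|a s IHs] [|t ts] // sts its; first exact: rt_refl.
  exact: rt_refl.
have /andP[it its'] : link_clique i t && all (link_clique i) ts by [].
apply: (@rt_trans _ _ _ ((ltr a :: enum t) ++ (map (@ltr n G X i) s ++ flat_enum ts))).
  apply: reach12_cat; first exact: reach12_enumU1.
  exact: IHs.
rewrite -[ltr a :: _]cat1s -!catA -[map _ (a :: s)]cat1s -catA.
apply: reach12_cat; first exact: rt_refl.
rewrite !catA; apply: reach12_cat; last exact: rt_refl.
apply: reach12_swap => b c tb /mapP[d _ ->]; rewrite adj_sym.
apply: (@flat_enum_adj i b [:: t]); rewrite /= ?it //.
by rewrite /flat_enum /= cats0.
Qed.

Variable le : forall i : 'I_n, rel (X i).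

Lemma all_joinableP i (s : seq (X i)) ts :
  all_joinable adj s ts -> size s = size ts /\ all (link_clique i) ts.
Proof. by rewrite all_joinableE => /andP[/eqP]. Qed.

Lemma rule_reach012 v v' : rule le v v' ->
  reach012 (flat_listing v) (flat_listing v').
Proof.
(* For (R0) and (R1), shuffle the letters of [X i] to the front, apply one operation to that prefix,
   and shuffle back. *)
have ex (i : 'I_n) (s s' : seq (X i)) ts : size s = size ts ->
    (size s' <= size ts)%N -> all (link_clique i) ts ->
    op_x012 adj (map (@ltr n G X i) s ++ flat_enum ts)
                (map (@ltr n G X i) s' ++ flat_enum ts) ->
    reach012 (flat_listing (clique_word adj (joins s ts)))
      (flat_listing (clique_word adj (joins s' ts ++ drop (size s') ts))).
  move=> ss ss' its op.
  have cd : all clique_set (joins s' ts ++ drop (size s') ts).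
    rewrite all_cat joins_clique_set //=.
    by move: (link_clique_set its); rewrite -{1}(cat_take_drop (size s') ts) all_cat => /andP[].
  apply: rt_trans (_ : reach012 _ (flat_enum (joins s ts))) _.
    by apply/reach12_012/reach12_clique_word/joins_clique_set.
  have := reach12_joins (eq_leq ss) its; rewrite ss drop_size cats0.
  move=> /reach12_012 st; apply: rt_trans st _.
  apply: rt_trans (rt_step _ _ _ _ op) _.
  apply/reach12_012/(reach12_sym adj_sym); apply: rt_trans (reach12_clique_word cd) _.
  exact: reach12_joins.
case=> {v v'} [i s s' ts /all_joinableP[ss its] s's e|i s s' ts /all_joinableP[ss its] s's e _|].
- apply: ex => //; first by rewrite -ss ltnW.
  by apply: Or31; apply: (@OpX0 n G X i [::]).
- have := ex i s s' ts ss; rewrite s's ss drop_size cats0; apply=> //.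
  by apply: Or32; apply: (@OpX1 n G X i [::]).
(* (R2) is a mere shuffle: [a] passes the letters of [t]. *)
move=> [i a] t t'; rewrite -[existT _ _ _]/(ltr a) !joinable_ltr => ct it it'.
apply: reach12_012.
have [/andP[ct1 _] /andP[ct2 _]] := (it, it').
have := link_cliqueU1 a it'; rewrite is_clique_letterE => /andP[_ ct3].
have := link_cliqueU1 a it; rewrite is_clique_letterE => /andP[_ ct4].
apply: rt_trans (reach12_clique_word _) _; first by rewrite /= ct1 ct3.
apply/(reach12_sym adj_sym); apply: rt_trans (reach12_clique_word _) _.
  by rewrite /= ct4 ct2.
rewrite /flat_enum /= !cats0.
apply: rt_trans (reach12_cat (reach12_enumU1 a it) (rt_refl _ _ _)) _.
apply/(reach12_sym adj_sym).
apply: rt_trans (reach12_cat (rt_refl _ _ _) (reach12_enumU1 a it')) _.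
rewrite -[ltr a :: enum t']cat1s -[ltr a :: enum t]cat1s !catA.
apply: reach12_cat (rt_refl _ _ _).
apply: reach12_swap => b c tb; rewrite inE => /eqP ->; rewrite adj_sym.
apply: (@flat_enum_adj i b [:: t]); rewrite /= ?it //.
by rewrite /flat_enum /= cats0.
Qed.

Lemma rewrite_reach012 v v' : reachable (rewrite_step le) v v' ->
  reach012 (flat_listing v) (flat_listing v').
Proof.
apply: reachable_map => {}v {}v' [p l r q /rule_reach012 lr].
by rewrite !flat_listing_cat; apply: reach012_context.
Qed.

Lemma reach12_embed y : reach12 y (flat_listing (embed adj y)).
Proof.
apply: (reach12_sym adj_sym).
have {2}-> : y = flat_enum [seq [set a]%SET | a <- y].
  by elim: y => //= a y {1}->; rewrite /flat_enum /= enum_set1.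
apply: reach12_clique_word; apply/allP => _ /mapP[a _ ->].
by apply/clique_setP => b c; rewrite !inE => /eqP -> /eqP ->; rewrite eqxx.
Qed.

End CliqueLetters.

(** * Irreducible words have geodesic blocks *)

Section IrreducibleWords.
Variables (n : nat) (adj : rel 'I_n) (G : 'I_n -> groupType).
Variable X : forall i : 'I_n, {fset G i}.
Hypotheses (adj_sym : symmetric adj) (adj_irr : irreflexive adj).
Variable listing : clique_letter adj X -> seq (letter X).
Hypothesis listingP :
  forall t : clique_letter adj X, perm_eq (listing t) (enum (val t)).
Variable le : forall i : 'I_n, rel (X i).

Implicit Types (a b : letter X) (t : {set letter X}).

Local Notation vev i := (@vertex_ev n G X i).

Lemma proj_link i (s : seq (letter X)) :
  (forall b, b \in s -> adj i (tag b)) -> proj adj i s = [::].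
Proof.
elim: s => // b s IHs ibs; rewrite proj_neq.
  by rewrite ibs ?mem_head // IHs // => c cs; apply: ibs; rewrite inE cs orbT.
by apply: contraTneq (ibs b (mem_head b s)) => ->; rewrite adj_irr.
Qed.

Lemma proj_avoid i (s : seq (letter X)) : (forall b, b \in s -> tag b != i) ->
  exists2 k, proj adj i s = nseq k None &
    k = 0%N -> forall b, b \in s -> adj i (tag b).
Proof.
elim: s => [|b s IHs] bs; first by exists 0%N.
have [c cs|k ks k0] := IHs; first by apply: bs; rewrite inE cs orbT.
rewrite proj_neq ?bs ?mem_head // ks; case: ifPn => ib.
  by exists k => // /k0 is_ c; rewrite inE => /predU1P[->|/is_].
by exists k.+1.
Qed.

(** If a clique contains a letter of [X i], its other letters are adjacent to [i] and vanish.
    Otherwise each letter not adjacent to [i] yields a dollar sign. *)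
Lemma proj_listing i (t : clique_letter adj X) :
  (exists2 b : X i, ltr b \in val t & proj adj i (listing t) = [:: Some b]) \/
  (exists2 k, proj adj i (listing t) = nseq k None &
    k = 0%N -> link_clique adj i (val t)).
Proof.
have mem_l b : (b \in listing t) = (b \in val t).
  by rewrite (perm_mem (listingP t)) mem_enum.
have ct := clique_letter_set adj_irr t.
have [/hasP[a]|/hasPn ti] := boolP (has (fun a => tag a == i) (listing t)).
  have [[b ->]|/negPf ->//] := letter_tagP i a; rewrite mem_l => bt _.
  left; exists b => //.
  have U : uniq (listing t) by rewrite (perm_uniq (listingP t)) enum_uniq.
  have adj_b c : c \in listing t -> c != ltr b -> adj i (tag c).
    rewrite mem_l => tc cb; rewrite eq_sym in cb.
    exact: (clique_setP _ _ ct (ltr b) c).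
  move: bt; rewrite -mem_l => bt; case/splitPr: bt U adj_b => s1 s2 U adj_b.
  move: U; rewrite cat_uniq /= => /and4P[_ /norP[bs1 _] bs2 _].
  rewrite proj_cat proj_ltr !proj_link // => c cs.
    apply: adj_b; first by rewrite mem_cat inE cs !orbT.
    by apply: contraNneq bs2 => <-.
  apply: adj_b; first by rewrite mem_cat cs.
  by apply: contraNneq bs1 => <-.
right; have [k lk k0] := proj_avoid ti; exists k => // /k0 it.
by rewrite /link_clique ct; apply/forall_inP => b; rewrite -mem_l; apply: it.
Qed.

Lemma irreducible_behead (x : clique_letter adj X) v :
  irreducible le (x :: v) -> irreducible le v.
Proof.
move=> nv v' vv'; apply: (nv (x :: v')).
by case: vv' => p l r q lr; apply: (RewriteStep (x :: p)).
Qed.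

(* Irreducibility with respect to (R2) brings together the letters of a block
   of [proj adj i], which may then be rewritten by (R0). *)
Lemma irreducible_first_block i v : irreducible le v ->
  let u := first_block (proj adj i (flat_listing listing v)) in
  exists ts q, all_joinable adj u ts /\ v = clique_word adj (joins u ts) ++ q.
Proof.
elim: v => [_|t v IHv nv]; first by exists [::], [::].
have [ts [q [uts vE]]] := IHv (irreducible_behead nv).
rewrite [flat_listing _ _]/(listing t ++ flat_listing listing v) proj_cat.
move: uts vE; set u := first_block _ => uts vE.
have ct := clique_letter_set adj_irr t.
have [[b bt ->]|[k -> k0]] := proj_listing i t.
  (* The letter [b] of [t] prolongs the block, the rest of [t] serving as its companion set. *)
  exists ((val t :\ ltr b)%SET :: ts), q.
  have it : link_clique adj i (val t :\ ltr b)%SET.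
    apply/andP; split.
      apply/clique_setP => c d; rewrite !inE => /andP[_ tc] /andP[_ td].
      exact: (clique_setP _ _ ct).
    apply/forall_inP => c; rewrite !inE => /andP[cb tc]; rewrite eq_sym in cb.
    exact: (clique_setP _ _ ct (ltr b) c).
  split; first by rewrite /all_joinable /= joinable_ltr // it.
  have tE : (ltr b |: val t :\ ltr b)%SET = val t by rewrite finset.setD1K.
  have clt := valP t.
  rewrite -[joins _ _]/((ltr b |: val t :\ ltr b)%SET :: joins u ts) tE.
  rewrite (clique_word_cons _ clt) cat_cons -vE; congr (_ :: _).
  exact: val_inj.
case: k k0 => [|k] k0 /=; last by exists [::], (t :: v).
have {k0} it := k0 erefl.
rewrite -/u; case: (u) ts uts vE => [|b u'] [|t' ts] // uts vE.
  by exists [::], (t :: v).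
have /andP[bt' uts'] : joinable adj (ltr b) t' && all_joinable adj u' ts by [].
have clt := valP t; have clt' : is_clique_letter adj (ltr b |: t')%SET by case/and3P: bt'.
(* Here [t] is invisible to the projection and the block starts in the next set, so (R2) could move
   [b] into [t], against irreducibility. *)
have tbt' : rule le (clique_word adj [:: val t; (ltr b |: t')%SET])
    (clique_word adj [:: (ltr b |: val t)%SET; t']).
  by apply: RuleR2 => //; rewrite joinable_ltr.
have st := RewriteStep [::] (clique_word adj (joins u' ts) ++ q) tbt'.
case: (nv (clique_word adj [:: (ltr b |: val t)%SET; t'] ++ clique_word adj (joins u' ts) ++ q)).
have -> : t :: v = [::] ++ clique_word adj [:: val t; (ltr b |: t')%SET]
    ++ (clique_word adj (joins u' ts) ++ q); last exact: st.
rewrite vE -[joins _ _]/((ltr b |: t')%SET :: joins u' ts).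
rewrite (clique_word_cons _ clt) !(clique_word_cons _ clt') /=.
by congr (_ :: _); apply: val_inj.
Qed.

Lemma irreducible_blocks_geodesic i v : irreducible le v ->
  blocks_geodesic (vev i) (proj adj i (flat_listing listing v)).
Proof.
elim: v => // t v IHv nv; have {IHv} := IHv (irreducible_behead nv).
have [ts [q [uts vE]]] := irreducible_first_block i nv.
move: uts vE; rewrite [flat_listing _ _]/(listing t ++ flat_listing listing v).
rewrite proj_cat; have [[b bt ->]|[k -> k0]] := proj_listing i t; last first.
  by move=> _ _; elim: (k).
move=> uts vE bv; split=> //; apply: contrapT => /not_geodesic[w ew sw].
apply: (nv _); rewrite vE -[clique_word _ _ ++ q]cat0s.
apply: RewriteStep; exact: (RuleR0 le uts sw ew).
Qed.

End IrreducibleWords.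

(** * Termination of R by a lexicographic measure *)

Section Termination.
Variables (n : nat) (adj : rel 'I_n) (G : 'I_n -> groupType).
Variable X : forall i : 'I_n, {fset G i}.
Hypotheses (adj_sym : symmetric adj) (adj_irr : irreflexive adj).
Variable le : forall i : 'I_n, rel (X i).
Hypothesis le_total : forall i : 'I_n, total_order_rel le i.

Implicit Types (a b : letter X) (t : {set letter X}) (L : seq {set letter X}).

Definition total_card L : nat := \sum_(t <- L) #|t|.

(* Each letter is counted as many times as there are sets before its own. *)
Fixpoint displacement L : nat :=
  if L is _ :: L' then (displacement L' + total_card L')%N else 0%N.

(** The position of the letter in the order on its [X i]; it turns (R1) into a numerical
    decrease. *)
Definition letter_rank a : nat :=
  #|[set b : X (tag a) | le b (tagged a) && (b != tagged a)]%SET|.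

Definition set_rank t : nat := \sum_(a in t) letter_rank a.

(** Exceeds the rank of every set, as a set contributes at most the sum of all letter ranks. *)
Definition rank_base : nat := (\sum_(a : letter X) letter_rank a).+1.

(* The value of the ranks of L read as digits in base [rank_base]. *)
Fixpoint rank_value L : nat :=
  if L is t :: L' then (set_rank t * rank_base ^ size L' + rank_value L')%N
  else 0%N.

Lemma total_card_cat L1 L2 :
  total_card (L1 ++ L2) = (total_card L1 + total_card L2)%N.
Proof. by rewrite /total_card big_cat. Qed.

Lemma total_card_cons t L : total_card (t :: L) = (#|t| + total_card L)%N.
Proof. by rewrite /total_card big_cons. Qed.

Lemma displacement_cat L1 L2 : displacement (L1 ++ L2) =
  (displacement L1 + displacement L2 + size L1 * total_card L2)%N.
Proof.
elim: L1 => [|t L1 IHL1] /=; first by rewrite mul0n addn0.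
by rewrite IHL1 total_card_cat mulSn; lia.
Qed.

Lemma rank_value_cat L1 L2 : rank_value (L1 ++ L2) =
  (rank_value L1 * rank_base ^ size L2 + rank_value L2)%N.
Proof.
elim: L1 => [|t L1 IHL1] //=.
by rewrite IHL1 size_cat expnD mulnDl mulnA addnA.
Qed.

Lemma set_rank_lt t : (set_rank t < rank_base)%N.
Proof.
rewrite /set_rank /rank_base ltnS [in leqRHS](bigID (fun a => a \in t)) /=.
exact: leq_addr.
Qed.

Lemma rank_value_lt L : (rank_value L < rank_base ^ size L)%N.
Proof.
elim: L => [|t L IHL] //=; rewrite expnS.
apply: (@leq_trans ((set_rank t).+1 * rank_base ^ size L)); last first.
  by rewrite leq_mul2r set_rank_lt orbT.
by rewrite mulSn addnC ltn_add2r.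
Qed.

Lemma letter_rank_lt i (a b : X i) :
  le b a -> a != b -> (letter_rank (ltr b) < letter_rank (ltr a))%N.
Proof.
have [_ le_anti le_trans _] := le_total i.
move=> ba ab; apply/proper_card/properP; split.
  apply/subsetP => c; rewrite !inE /= => /andP[cb cnb].
  rewrite (le_trans _ _ _ cb ba) /=; apply: contraNneq ab => ca.
  by apply/eqP/le_anti; rewrite ba -ca cb.
by exists b; rewrite !inE /= ?ba ?eqxx ?andbF // eq_sym.
Qed.

Lemma set_rankU1 i (a : X i) t : link_clique adj i t ->
  set_rank (ltr a |: t)%SET = (letter_rank (ltr a) + set_rank t)%N.
Proof.
by move=> it; rewrite /set_rank finset.big_setU1 //; apply: link_clique_notin it.
Qed.

Lemma size_joins i (s : seq (X i)) L : size (joins s L) = minn (size s) (size L).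
Proof. by rewrite /joins size_map size_zip. Qed.

Lemma joins_cons i (a : X i) s t L :
  joins (a :: s) (t :: L) = (ltr a |: t)%SET :: joins s L.
Proof. by []. Qed.

Lemma total_card_joins i (s : seq (X i)) L : all (link_clique adj i) L ->
  (size s <= size L)%N ->
  total_card (joins s L ++ drop (size s) L) = (size s + total_card L)%N.
Proof.
elim: s L => [|a s IHs] [|t L] // iL sL.
have /andP[it iL'] : link_clique adj i t && all (link_clique adj i) L by [].
rewrite joins_cons cat_cons !total_card_cons /= IHs //.
by rewrite cardsU1 (link_clique_notin adj_irr a it) addnACA.
Qed.

(** The added letters have 0, 1, 2, ... sets before them, whence the binomial coefficient; it does
    not depend on [s], so (R1) preserves displacement. *)
Lemma displacement_joins i (s : seq (X i)) L : all (link_clique adj i) L ->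
  size s = size L ->
  displacement (joins s L) = (displacement L + 'C(size L, 2))%N.
Proof.
elim: s L => [|a s IHs] [|t L] // iL [sL].
have /andP[it iL'] : link_clique adj i t && all (link_clique adj i) L by [].
rewrite joins_cons /= IHs // binS bin1.
have := total_card_joins iL' (eq_leq sL); rewrite sL drop_size cats0 => ->.
lia.
Qed.

(** The first differing letter lowers its digit, and by [rank_value_lt] all later digits together
    stay below one unit of it. *)
Lemma rank_value_joins i (s s' : seq (X i)) L : all (link_clique adj i) L ->
  size s = size L -> size s' = size L -> lex_lt le s' s ->
  (rank_value (joins s' L) < rank_value (joins s L))%N.
Proof.
elim: L s s' => [|t L IHL] [|a s] [|b s'] // iL [sL] [s'L].
have /andP[it iL'] : link_clique adj i t && all (link_clique adj i) L by [].
rewrite !joins_cons /= !set_rankU1 //; have [->|ba] := eqVneq b a.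
  by move=> ss'; rewrite !size_joins sL s'L ltn_add2l IHL.
move=> le_ba; rewrite eq_sym in ba; have lt_ba := letter_rank_lt le_ba ba.
have := rank_value_lt (joins s' L); rewrite !size_joins sL s'L => lt_s'.
rewrite minnn in lt_s' *.
apply: (@leq_trans ((letter_rank (ltr b) + set_rank t).+1 * rank_base ^ size L)).
  by rewrite mulSn [leqRHS]addnC ltn_add2l.
by apply: leq_trans (leq_addr _ _); rewrite leq_mul2r ltn_add2r lt_ba orbT.
Qed.

Lemma val_clique_word L :
  map val (clique_word adj L) = [seq t <- L | is_clique_letter adj t].
Proof.
elim: L => // t L IHL; have [ct|ct] := boolP (is_clique_letter adj t).
  by rewrite (clique_word_cons _ ct) /= ct IHL.
by rewrite clique_word_skip //= (negPf ct).
Qed.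

Lemma total_card_clique_word L : all (@clique_set n adj G X) L ->
  total_card (map val (clique_word adj L)) = total_card L.
Proof.
elim: L => // t L IHL /andP[ct cL]; rewrite total_card_cons -(IHL cL).
have [t0|t0] := boolP (is_clique_letter adj t).
  by rewrite (clique_word_cons _ t0) total_card_cons.
rewrite clique_word_skip //; move: t0; rewrite is_clique_letterE // ct andbT negbK.
by move=> /eqP ->; rewrite cards0.
Qed.

Lemma joins_clique_word i (s : seq (X i)) L : all (link_clique adj i) L ->
  map val (clique_word adj (joins s L)) = joins s L.
Proof.
move=> iL; rewrite val_clique_word; apply/all_filterP.
elim: s L iL => [|a s IHs] [|t L] // iL.
have /andP[it iL'] : link_clique adj i t && all (link_clique adj i) L by [].
by rewrite joins_cons /= link_cliqueU1 // IHs.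
Qed.

(** (R0) removes letters. (R2) keeps their number and moves one of them a set to the left. (R1)
    preserves both quantities and lowers the rank value. *)
Lemma rewrite_step_decreases (v v' : seq (clique_letter adj X))
    (w := map val v) (w' := map val v') :
  rewrite_step le v v' -> (total_card w' < total_card w)%N \/
  total_card w' = total_card w /\
    ((displacement w' < displacement w)%N \/ displacement w' = displacement w /\
     (rank_value w' < rank_value w)%N).
Proof.
rewrite {}/w {}/w' => -[{v v'} p l r q lr]; rewrite !map_cat.
move: (map val p) (map val q) => {}p {}q.
rewrite !total_card_cat !displacement_cat !total_card_cat !rank_value_cat.
case: lr => {l r} [i s s' L|i s s' L|[i a] t t'].
- move=> /(all_joinableP adj_sym adj_irr)[sL iL] s's _; left.
  rewrite ltn_add2l ltn_add2r.
  rewrite !total_card_clique_word ?all_cat ?joins_clique_set //=; last first.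
    have := link_clique_set iL.
    by rewrite -{1}(cat_take_drop (size s') L) all_cat => /andP[].
  rewrite total_card_joins //; last by rewrite -sL ltnW.
  have := total_card_joins iL (eq_leq sL); rewrite {1}sL drop_size cats0 => ->.
  by rewrite ltn_add2r.
- move=> /(all_joinableP adj_sym adj_irr)[sL iL] s's _ lt_s's; right.
  have s'L : size s' = size L by rewrite s's.
  have lex : lex_lt le s' s by move: lt_s's; rewrite /shortlex_lt s's ltnn eqxx.
  rewrite !joins_clique_word //.
  have := total_card_joins iL (eq_leq sL); rewrite {1}sL drop_size cats0 => ->.
  have := total_card_joins iL (eq_leq s'L); rewrite {1}s'L drop_size cats0 => ->.
  rewrite !displacement_joins // !size_cat !size_joins s's; split=> //; right.
  split=> //; rewrite ltn_add2l ltn_add2r ltn_mul2r expn_gt0 /=.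
  exact: rank_value_joins.
rewrite -[existT _ _ _]/(ltr a) => ct; rewrite !joinable_ltr // => it it'.
have ct' := link_cliqueU1 adj_sym adj_irr a it'; have cat := link_cliqueU1 adj_sym adj_irr a it.
have at_ := link_clique_notin adj_irr a it; have at' := link_clique_notin adj_irr a it'.
rewrite !val_clique_word /= ct ct' cat; right.
(* An empty [t'] is dropped from the word, so one set disappears, which cannot increase the
   displacement of what follows. *)
have [t0|t0] := eqVneq t' finset.set0.
  have -> : is_clique_letter adj t' = false by rewrite is_clique_letterE // t0 eqxx.
  rewrite /= !total_card_cons !cardsU1 at_ at' t0 cards0 /total_card !big_nil.
  split; lia.
have -> : is_clique_letter adj t' by rewrite is_clique_letterE // t0; case/andP: it'.
rewrite /= !total_card_cons !cardsU1 at_ at' /total_card !big_nil.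
split; lia.
Qed.

Lemma rewriting_terminates (v : seq (clique_letter adj X)) :
  exists2 v', reachable (rewrite_step le) v v' & irreducible le v'.
Proof.
apply: (lex_terminating (f := fun v => total_card (map val v))
  (g := fun v => displacement (map val v)) (h := fun v => rank_value (map val v))).
exact: rewrite_step_decreases.
Qed.

End Termination.

(** * The cycle of implications *)

Theorem proposition3p3 (n : nat) (adj : rel 'I_n)
  (adj_sym : symmetric adj) (adj_irr : irreflexive adj)
  (G : 'I_n -> groupType) (X : forall i : 'I_n, {fset G i})
  (X_gen : forall i : 'I_n, generates (X i))
  (X_inv : forall i : 'I_n, inverse_closed (X i))
  (le : forall i : 'I_n, rel (X i))
  (le_total : forall i : 'I_n, total_order_rel le i)
  (listing : clique_letter adj X -> seq (letter X))
  (listingP : forall t : clique_letter adj X,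
    perm_eq (listing t) (enum (val t)))
  (y : seq (letter X)) :
  [<-> geodesic (@letter_ev n adj G X) y;
       trimmed adj y;
       forall i : 'I_n, proj_language (proj adj i y);
       reachable (op_x12 adj (X := X)) y (Theta le listing y)].
Proof.
have geodesic_of z : (forall i, proj_language (proj adj i z)) ->
    geodesic (@letter_ev n adj G X) z.
  exact: proj_geodesic.
(* Termination provides a normal form, so [xget] does not fall back on its default. *)
have [irr_reach irr_irr] : reachable (rewrite_step le) (embed adj y) (irr adj le y) /\
    irreducible le (irr adj le y).
  rewrite /irr; case: classical_sets.xgetP => [v _ []//|none].
  have [v yv nv] := rewriting_terminates adj_sym adj_irr le_total (embed adj y).
  by case: (none v).
(* This holds for arbitrary [y], since (iii) implies (i) for the flattened irreducible word. *)
have gTheta : geodesic (@letter_ev n adj G X) (Theta le listing y).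
  apply: geodesic_of => i; apply/proj_languageP.
  exact: irreducible_blocks_geodesic irr_irr.
split; [exact: geodesic_trimmed | split; [|split]].
- by move=> ty i; apply/proj_languageP; apply: trimmed_blocks_geodesic.
(* (iii) implies (iv): the simulated rewriting leads from [y] to its image under [Theta], and
   starting from a trimmed word it cannot contain (x0). *)
- move=> yL; apply: trimmed_reach12; first exact/geodesic_trimmed/geodesic_of.
  apply: rt_trans (rewrite_reach012 adj_sym adj_irr listingP irr_reach).
  exact/reach12_012/reach12_embed.
(* (iv) implies (i): (x1) and (x2) preserve element and length, so [y] is as short as a geodesic. *)
- move=> /reach12_eval_size[ev sz] w; rewrite -ev -sz; exact: gTheta.
Qed.
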